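(* Let $d\geqslant 5$ be an odd integer and let $r$ be an even integer with $\gcd(d,r)=1$. Let $n>1$ be an odd integer with $n\equiv -r\pmod{d}$ and $n\geqslant \max\{r,d-r\}$. Then \[ \sum_{k=0}^{n-1}[2dk+r]_{q^2}\frac{(q^{2r};q^{2d})_k^d}{(q^{2d};q^{2d})_k^d}q^{d(d-r-2)k} \equiv 0\pmod{\Phi_n(q)^2}. \]
   Context: $q$ is an indeterminate. The $q$-shifted factorial is $(a;q)_k=(1-a)(1-aq)\cdots(1-aq^{k-1})$ (with $(a;q)_0=1$), and $(a;q^{2d})_k$ is defined analogously with base $q^{2d}$. For any integer $m$ (including negative $m$), $[m]_{q^2}=(1-q^{2m})/(1-q^2)$. $\Phi_n(q)$ denotes the $n$-th cyclotomic polynomial. A congruence of rational functions modulo a polynomial $P(q)$, where the denominators are coprime to $P(q)$, means that $P(q)$ divides the numerator of the difference in lowest terms. *)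

(* Defs.v *)
From HB Require Import structures.
From mathcomp Require Import all_boot all_order all_algebra.
From mathcomp Require Import cyclotomic.
Set Implicit Arguments. Unset Strict Implicit. Unset Printing Implicit Defensive.
Import Order.TTheory GRing.Theory Num.Theory.
Local Open Scope ring_scope.

Definition RF := {fraction {poly rat}}.

Definition qq : RF := tofrac ('X : {poly rat}).

Definition qpow (m : int) : RF := qq ^ m.

Definition qpoch (a b : RF) (k : nat) : RF := \prod_(j < k) (1 - a * b ^+ j).

Definition qint2 (m : int) : RF := (1 - qpow (2 * m)) / (1 - qpow 2).

Definition PhiQ (n : nat) : {poly rat} := map_poly intr ('Phi_n).

(* Congruence of rational functions modulo a polynomial P:
   x = y (mod P) iff x - y = (P*a)/b with b coprime to P (equivalently,
   P divides the numerator of x - y in lowest terms). *)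
Definition congr_mod (x y : RF) (P : {poly rat}) : Prop :=
  exists a b : {poly rat}, b != 0 /\ coprimep b P /\
    x - y = tofrac (P * a) / tofrac b.

(* Main.v *)
Require Import Defs.
From mathcomp Require Import all_boot all_order all_algebra.
From mathcomp Require Import cyclotomic.
From mathcomp Require Import qpoly algC ring zify.
Set Implicit Arguments. Unset Strict Implicit. Unset Printing Implicit Defensive.
Import GRing.Theory Num.Theory.
Local Open Scope ring_scope.

(* Write s(i) = q^i - q^(-i) and sigma(i) = s(d i). All powers of q cancel and,
   up to a factor independent of k, the k-th summand is
   T(k) = s(2dk + r) (prod_(j < k) s(r + d j) / sigma(j + 1))^d,
   where r = d t - n with t = 2v + 1 odd. In Q[q]/Phi_n^2 the element
   eps = q^n - 1 has square zero, so s(i - e n) = s(i) + O(eps) is affine in e;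
   hence s(i - n)^d = s(i)^(d-1) s(i - d n), and T(k) equals
   s(d(2k + t) - n) (b(k) / b(0))^(d-1) C(k), where b(k) = prod_(0 < j < t)
   sigma(k + j) and C(k) is (-1)^k times a q-binomial coefficient of even order
   M = n - t. Replacing s(d(2k + t) - n) by sigma(2k - M) and shifting the
   arguments of half of the factors b(k) by n gives terms Tsym(k) that are
   exactly antisymmetric under k -> M - k, so sum to 0. The error
   T(k) - Tsym(k) is proportional to V(k) - V(k - n), where
   V(k) = sigma(2k + t) b(k)^d is a Laurent polynomial in q^(2dk) with exponents
   less than n in absolute value; such differences sum to 0 over k < n, since
   for y = q^(2di) that sum is a multiple of (y^n - 1)^2 / (y - 1). *)

(** * Symmetric q-numbers and their first-order behaviour under shifts by [n] *)

Section SymmetricQNumbers.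

Variables (A : comUnitRingType) (q : A).
Hypothesis q_unit : q \is a GRing.unit.

Definition qsym (i : int) : A := q ^ i - q ^ (- i).
Definition qcosym (i : int) : A := q ^ i + q ^ (- i).

Lemma qsymN i : qsym (- i) = - qsym i.
Proof. by rewrite /qsym opprK opprB. Qed.

Lemma qsym0 : qsym 0 = 0.
Proof. by rewrite /qsym oppr0 subrr. Qed.

Lemma qsym_factor i : qsym i = q ^ (- i) * (q ^ (2 * i) - 1).
Proof.
rewrite /qsym mulrBr mulr1 -exprzDr //.
by congr (q ^ _ - _); lia.
Qed.

Variable n : nat.
Let eps := q ^+ n - 1.
Hypothesis eps_sq : eps * eps = 0.

Lemma add_eps_exp (x y : A) k :
  (x + eps * y) ^+ k.+1 = x ^+ k.+1 + k.+1%:R * eps * y * x ^+ k.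
Proof.
elim: k => [|k IHk]; first by rewrite !expr1 expr0; ring.
rewrite exprS IHk !exprS.
have -> : k.+2%:R = k.+1%:R + 1 :> A by rewrite -natr1.
have e2 : forall a, eps * eps * a = 0 by move=> a; rewrite eps_sq mul0r.
(* The cross term of the product, quadratic in [eps], is added as a zero so that [ring] can
   conclude. *)
rewrite -[RHS]addr0 -(e2 (k.+1%:R * y * y * x ^+ k)).
ring.
Qed.

Lemma q_shift i (e : nat) : q ^ (i - (e * n)%:Z) = q ^ i * (1 - e%:R * eps).
Proof.
have up (f : nat) : q ^ (f * n)%:Z = 1 + f%:R * eps.
  rewrite mulnC -exprnP exprM -[q ^+ n](subrK 1) -/eps addrC -[eps]mulr1.
  by case: f => [|f]; [ring | rewrite add_eps_exp !expr1n; ring].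
rewrite exprzDr //; congr (_ * _).
have E : q ^ (e * n)%:Z * q ^ (- (e * n)%:Z) = 1.
  by rewrite -exprzDr // subrr.
rewrite -[LHS]mulr1 -[1 in LHS](_ : (1 + e%:R * eps) * (1 - e%:R * eps) = 1).
  by rewrite mulrA -up mulrC [_ * q ^ _]mulrC E mulr1.
have -> : (1 + e%:R * eps) * (1 - e%:R * eps) = 1 - e%:R * e%:R * (eps * eps).
  by ring.
by rewrite eps_sq mulr0 subr0.
Qed.

Lemma qsym_shift i (e : nat) :
  qsym (i - (e * n)%:Z) = qsym i - e%:R * eps * qcosym i.
Proof.
rewrite /qsym /qcosym q_shift.
have -> : q ^ (- (i - (e * n)%:Z)) = q ^ (- i) * (1 + e%:R * eps).
  rewrite -[in RHS](_ : - (i - (e * n)%:Z) - (e * n)%:Z = - i); last by lia.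
  rewrite q_shift -mulrA.
  have -> : (1 - e%:R * eps) * (1 + e%:R * eps) = 1 - e%:R * e%:R * (eps * eps).
    by ring.
  by rewrite eps_sq mulr0 subr0 mulr1.
by ring.
Qed.

(** To first order in [eps], each side loses [k.+1 * eps * qcosym i * qsym i ^+ k] from
    [qsym i ^+ k.+1]. *)
Lemma qsym_shift_exp i k :
  qsym (i - n%:Z) ^+ k.+1 = qsym i ^+ k * qsym (i - (k.+1 * n)%:Z).
Proof.
rewrite -[in LHS](mul1n n) !qsym_shift mul1r -mulrN add_eps_exp exprSr; ring.
Qed.

End SymmetricQNumbers.

(** * Laurent polynomials in [g ^ k] and sums of their differences *)

Section LaurentSequences.

Variables (A : comUnitRingType) (g : A).
Hypothesis g_unit : g \is a GRing.unit.

(** The exponents of [g ^ k] lie between [-N] and [N] and have the parity of [N]; taking out the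
    lowest power leaves an ordinary polynomial in [g ^ (2 * k)]. *)
Definition laurent (N : nat) (f : int -> A) : Prop :=
  exists2 P : {poly A}, (size P <= N.+1)%N
    & forall k, f k = g ^ (- (N%:Z * k)) * P.[g ^ (2 * k)].

Lemma laurent_mul N1 N2 f1 f2 :
  laurent N1 f1 -> laurent N2 f2 -> laurent (N1 + N2) (fun k => f1 k * f2 k).
Proof.
case=> P1 sP1 E1 [P2 sP2 E2]; exists (P1 * P2) => [|k].
  by apply: leq_trans (size_polyMleq _ _) _; lia.
rewrite E1 E2 hornerM mulrACA -exprzDr //.
by congr (g ^ _ * _); lia.
Qed.

Lemma laurent_prod N m (f : nat -> int -> A) :
  (forall j, laurent N (f j)) ->
  laurent (m * N) (fun k => \prod_(j < m) f j k).
Proof.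
move=> Lf; elim: m => [|m [P sP E]].
  exists 1 => [|k]; first by rewrite size_poly1.
  by rewrite big_ord0 mul0r oppr0 hornerC mulr1.
have [Q sQ E'] := laurent_mul (Lf m) (ex_intro2 _ _ P sP E).
by exists Q => // k; rewrite mulSn -E' big_ord_recr mulrC.
Qed.

Lemma laurent_exp N m f : laurent N f -> laurent (m * N) (fun k => f k ^+ m).
Proof.
move=> Lf; have [P sP E] := laurent_prod m (fun=> Lf).
by exists P => // k; rewrite -E prodr_const card_ord.
Qed.

Lemma laurent_qsym (N : nat) (i : int) :
  laurent N (fun k => g ^ (N%:Z * k + i) - g ^ (- (N%:Z * k + i))).
Proof.
exists (g ^ i *: 'X^N - (g ^ (- i))%:P) => [|k].
  rewrite (leq_trans (size_polyD _ _)) // geq_max size_polyN.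
  rewrite (leq_trans (size_scale_leq _ _)) ?size_polyXn //=.
  exact: leq_trans (size_polyC_leq1 _) _.
rewrite !hornerE exprnP exprz_exp mulrBr mulrCA -!exprzDr //.
by congr (g ^ _ - g ^ _); lia.
Qed.

End LaurentSequences.

(** Multiplied by [y - 1], the sum becomes [y ^ (-n) * (y ^ n - 1) ^ 2]. *)
Lemma sum_shift_powers (A : comUnitRingType) (y : A) n :
  y \is a GRing.unit -> (y ^+ n - 1) ^+ 2 = 0 -> y - 1 \is a GRing.unit ->
  \sum_(k < n) (y ^ k%:Z - y ^ (k%:Z - n%:Z)) = 0.
Proof.
move=> Uy y2 Uy1; apply: (mulrI Uy1); rewrite mulr0.
have -> : \sum_(k < n) (y ^ k%:Z - y ^ (k%:Z - n%:Z)) =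
          (1 - y ^ (- n%:Z)) * \sum_(k < n) y ^+ k.
  rewrite mulr_sumr; apply: eq_bigr => k _.
  by rewrite exprzDr // mulrBl mul1r [_ * y ^ (- _)]mulrC.
rewrite mulrCA -subrX1.
have -> : 1 - y ^ (- n%:Z) = y ^ (- n%:Z) * (y ^+ n - 1).
  by rewrite mulrBr mulr1 exprnP -exprzDr // addNr.
by rewrite -mulrA -expr2 y2 mulr0.
Qed.

(** By linearity, only the powers of [g ^ 2] with exponent [i - m] matter. As [|i - m| <= m < n],
    each is 1 or satisfies the unit hypothesis of [sum_shift_powers]. *)
Lemma sum_shift_laurent (A : comUnitRingType) (g : A) m n (f : int -> A) :
  g \is a GRing.unit -> ((g ^ 2) ^+ n - 1) ^+ 2 = 0 ->
  (forall i, (0 < i < n)%N -> (g ^ 2) ^+ i - 1 \is a GRing.unit) ->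
  (m < n)%N -> laurent g (2 * m) f ->
  \sum_(k < n) (f k%:Z - f (k%:Z - n%:Z)) = 0.
Proof.
move=> Ug p2 Up ltmn [P sP E]; set p := g ^ 2 in p2 Up.
have Upu : p \is a GRing.unit by rewrite unitrXz.
have Ef k : f k = \sum_(i < (2 * m).+1) P`_i * (p ^ (i%:Z - m%:Z)) ^ k.
  rewrite E (horner_coef_wide _ sP) mulr_sumr; apply: eq_bigr => i _.
  rewrite mulrCA /p !exprz_exp exprnP exprz_exp -exprzDr //.
  by congr (_ * g ^ _); lia.
under eq_bigr do rewrite !Ef -sumrB.
rewrite exchange_big big1 // => i _ /=.
under eq_bigr do rewrite -mulrBr.
rewrite -mulr_sumr; suff -> : \sum_(k < n) ((p ^ (i%:Z - m%:Z)) ^ k%:Z -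
    (p ^ (i%:Z - m%:Z)) ^ (k%:Z - n%:Z)) = 0 by rewrite mulr0.
have [j j_lt Ej] : exists2 j : nat, (j < n)%N
    & i%:Z - m%:Z = j%:Z \/ i%:Z - m%:Z = - j%:Z.
  by exists `|i%:Z - m%:Z|%N; have := ltn_ord i; lia.
have y2 : ((p ^+ j) ^+ n - 1) ^+ 2 = 0.
  by rewrite exprAC subrX1 exprMn p2 mul0r.
case: (posnP j) Ej => [->|j_gt0] Ej.
  by rewrite big1 // => k _; case: Ej => ->; rewrite ?oppr0 !exp1rz subrr.
have Uj : p ^+ j - 1 \is a GRing.unit by rewrite Up ?j_gt0.
have Upj : p ^+ j \is a GRing.unit by rewrite unitrX.
case: Ej => ->; first exact: sum_shift_powers.
(* For a negative exponent, the hypotheses pass from [p ^+ j] to its inverse. *)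
rewrite -exprz_inv -[_ ^ j%:Z]exprnP exprVn.
apply: sum_shift_powers; rewrite ?unitrV //.
  have -> : (p ^+ j)^-1 ^+ n - 1 = - (p ^+ j)^-1 ^+ n * ((p ^+ j) ^+ n - 1).
    by rewrite mulNr mulrBr mulr1 exprVn mulVr ?unitrX // opprB.
  by rewrite exprMn y2 mulr0.
have -> : (p ^+ j)^-1 - 1 = - (p ^+ j)^-1 * (p ^+ j - 1).
  by rewrite mulNr mulrBr mulr1 mulVr // opprB.
by rewrite unitrM unitrN unitrV Upj.
Qed.

(** * Vanishing of the truncated sum when [q ^+ n - 1] has square zero *)

Section TruncatedSum.

Variables (A : comUnitRingType) (q : A) (n h v : nat).
Let d := (2 * h).+1.
Let t := (2 * v).+1.
Let M := (n - t)%N.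
Let eps := q ^+ n - 1.
Let sg (i : int) := qsym q (d%:Z * i).

Hypothesis h_gt0 : (0 < h)%N.
Hypothesis n_odd : odd n.
Hypothesis dv_lt : ((d * v).+1 < n)%N.
Hypothesis q_unit : q \is a GRing.unit.
Hypothesis eps_sq : eps * eps = 0.
Hypothesis sg_unit : forall i : nat,
  (0 < i < n)%N -> qsym q (d%:Z * i%:Z) \is a GRing.unit.

Let nE : n = (M + t)%N. Proof. rewrite /M /t; nia. Qed.
Let M_even : odd M = false. Proof. by rewrite /M /t; lia. Qed.

Let b (k : int) := \prod_(j < 2 * v) sg (k + j.+1%:Z).

Let sgN i : sg (- i) = - sg i.
Proof. by rewrite /sg mulrN qsymN. Qed.

Let fact (k : nat) := \prod_(j < k) sg j.+1%:Z.

Let fact_unit k : (k < n)%N -> fact k \is a GRing.unit.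
Proof.
rewrite /fact; elim: k => [|k IHk] ltkn; first by rewrite big_ord0 unitr1.
by rewrite big_ord_recr unitrM IHk ?sg_unit // ltnW.
Qed.

Let b0_unit : b 0 \is a GRing.unit.
Proof.
have -> : b 0 = fact (2 * v) by apply: eq_bigr => j _; rewrite add0r.
by apply: fact_unit; rewrite nE /t; lia.
Qed.

Let b_step (k : int) : b k * sg (k + t%:Z) = sg (k + 1) * b (k + 1).
Proof.
rewrite /b /t.
transitivity (\prod_(j < (2 * v).+1) sg (k + j.+1%:Z)).
  by rewrite big_ord_recr.
rewrite big_ord_recl; congr (_ * _); apply: eq_bigr => j _.
by congr (sg _); rewrite lift0; lia.
Qed.

(** Both sides are the product of [sg 1] up to [sg (k + t - 1)]. *)
Let prod_b (k : nat) : (\prod_(j < k) sg (t%:Z + j%:Z)) * b 0 = b k%:Z * fact k.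
Proof.
elim: k => [|k IHk]; first by rewrite /fact !big_ord0 mul1r mulr1.
rewrite /fact !big_ord_recr /= -/(fact k) mulrAC IHk mulrAC addrC b_step.
by rewrite -[k%:Z + 1]/(k%:Z + 1%:Z) -PoszD addn1; ring.
Qed.

Let C (k : nat) := (\prod_(j < k) sg (j%:Z - M%:Z)) / fact k.

Let sg_shift i (e : nat) :
  sg (i - (e * n)%:Z) = sg i - (e * d)%:R * eps * qcosym q (d%:Z * i).
Proof. by rewrite /sg mulrBr -PoszM mulnA (mulnC d) qsym_shift. Qed.

(** As [j - M = t + j - n], the factors agree modulo [eps], and the leading [eps] erases the
    difference. *)
Let eps_prod_sub (k : nat) :
  eps * \prod_(j < k) sg (j%:Z - M%:Z) = eps * \prod_(j < k) sg (t%:Z + j%:Z).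
Proof.
elim: k => [|k IHk]; first by rewrite !big_ord0.
rewrite !big_ord_recr /= !mulrA IHk -!mulrA mulrCA [RHS]mulrCA; congr (_ * _).
have -> : k%:Z - M%:Z = t%:Z + k%:Z - (1 * n)%:Z by rewrite nE; lia.
by rewrite sg_shift mulrBr -!mulrA [_%:R * _]mulrC !mulrA eps_sq !mul0r subr0.
Qed.

Let eps_C (k : nat) : (k < n)%N -> eps * C k = eps * b k%:Z / b 0.
Proof.
move=> ltkn; apply: (mulIr b0_unit); apply: (mulIr (fact_unit ltkn)).
rewrite mulrVK // /C mulrA eps_prod_sub mulrAC mulrVK ?fact_unit //.
by rewrite -!mulrA prod_b.
Qed.

Let C_vanish (k : nat) : (M < k)%N -> C k = 0.
Proof.
move=> ltMk; rewrite /C (bigD1 (Ordinal ltMk)) //= subrr.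
by rewrite /sg mulr0 qsym0 !mul0r.
Qed.

(** The [k] factors [sg (j - M)], once negated, are those missing from [fact (M - k)]. *)
Let fact_sub (k : nat) : (k <= M)%N ->
  fact (M - k) * \prod_(j < k) sg (j%:Z - M%:Z) = (- 1) ^+ k * fact M.
Proof.
elim: k => [|k IHk] lekM; first by rewrite big_ord0 subn0 mulr1 mul1r.
rewrite exprS mulN1r mulNr -IHk 1?ltnW // big_ord_recr /=.
have -> : (M - k)%N = (M - k.+1).+1 by lia.
rewrite [fact (M - k.+1).+1]/fact big_ord_recr /= -/(fact _).
have -> : k%:Z - M%:Z = - (M - k.+1).+1%:Z by lia.
by rewrite sgN; ring.
Qed.

Let C_sym (k : nat) : (k <= M)%N -> C (M - k) = C k.
Proof.
move=> lekM; have lt1 : (k < n)%N by rewrite nE /t; lia.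
have lt2 : (M - k < n)%N by rewrite nE /t; lia.
apply: (mulIr (fact_unit lt1)); apply: (mulIr (fact_unit lt2)).
rewrite /C mulrAC !mulrVK ?fact_unit //.
have := fact_sub (leq_subr k M); rewrite subKn // mulrC => ->.
(* The signs of exponents [M - k] and [k] agree because [M] is even. *)
rewrite [RHS]mulrC fact_sub // -signr_odd oddB // M_even /=.
by rewrite signr_odd.
Qed.

(** Since [M + 2v = n - 1], reversing the factors negates every argument; the [2v] signs cancel. *)
Let b_sym (k : int) : b (M%:Z - k) = b (k - n%:Z).
Proof.
rewrite /b (reindex_inj rev_ord_inj) /=.
transitivity (\prod_(j < 2 * v) - sg (k - n%:Z + j.+1%:Z)).
  apply: eq_bigr => j _; rewrite -sgN; congr (sg _).
  by have := ltn_ord j; rewrite nE /t; lia.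
by rewrite prodrN card_ord exprM sqrrN expr1n expr1n mul1r.
Qed.

(** The reflection of [k] to [M - k] exchanges [b k] and [b (k - n)], so both occur to the same
    power [h]. *)
Let Tsym (k : nat) :=
  sg (2 * k%:Z - M%:Z) * (b k%:Z * b (k%:Z - n%:Z)) ^+ h * C k.

Let Tsym_anti (k : nat) : (k <= M)%N -> Tsym (M - k) = - Tsym k.
Proof.
move=> lekM; rewrite /Tsym C_sym // -!mulNr -sgN.
have -> : (M - k)%:Z = M%:Z - k%:Z by lia.
rewrite b_sym.
have -> : M%:Z - k%:Z - n%:Z = M%:Z - (k%:Z + n%:Z) by lia.
rewrite b_sym addrK [b _ * b _]mulrC.
by congr (sg _ * _ * _); lia.
Qed.

Hypothesis two_unit : (2%:R : A) \is a GRing.unit.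

Let Tsym_sum : \sum_(k < n) Tsym k = 0.
Proof.
have leMn : (M.+1 <= n)%N by rewrite nE /t; lia.
have -> : \sum_(k < n) Tsym k = \sum_(k < M.+1) Tsym k.
  rewrite (big_ord_widen _ _ leMn) [RHS]big_mkcond /=.
  apply: eq_bigr => k _; case: ltnP => // ltMk.
  by rewrite /Tsym C_vanish ?mulr0.
apply: (mulrI two_unit); rewrite mulr0 mulr_natl mulr2n.
rewrite {1}(reindex_inj rev_ord_inj) /= -big_split big1 // => k _ /=.
by rewrite subSS Tsym_anti ?addNr // -ltnS.
Qed.

Let T (k : nat) :=
  qsym q (d%:Z * (2 * k%:Z + t%:Z) - n%:Z) *
  (\prod_(j < k) qsym q (d%:Z * (t%:Z + j%:Z) - n%:Z)) ^+ d / fact k ^+ d.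

(** By [qsym_shift_exp], the shifts by [n] of [d] equal factors gather into one shift by [d n],
    which turns [sg (t + j)] into [sg (j - M)]. *)
Let T_eq (k : nat) : (k < n)%N ->
  T k * b 0 ^+ (2 * h) =
  qsym q (d%:Z * (2 * k%:Z + t%:Z) - n%:Z) * b k%:Z ^+ (2 * h) * C k.
Proof.
move=> ltkn; rewrite /T /C.
have -> : (\prod_(j < k) qsym q (d%:Z * (t%:Z + j%:Z) - n%:Z)) ^+ d =
    (\prod_(j < k) sg (t%:Z + j%:Z)) ^+ (2 * h) * \prod_(j < k) sg (j%:Z - M%:Z).
  rewrite -!prodrXl -big_split; apply: eq_bigr => j _ /=.
  rewrite (qsym_shift_exp q_unit eps_sq) -/d; congr (_ * qsym q _).
  by rewrite nE; lia.
rewrite -mulrA mulrAC -!mulrA; congr (_ * _).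
have := congr1 (fun x => x ^+ (2 * h)) (prod_b k); rewrite !exprMn => E.
rewrite /d exprS invrM ?unitrX ?fact_unit //.
rewrite -[b k%:Z ^+ _](mulrK (unitrX (2 * h) (fact_unit ltkn))) -E.
by ring.
Qed.

(** The value of [y] is left open: it enters both sides of [T_sub_Tsym] alike. *)
Let b_shift (k : int) : exists y, b (k - n%:Z) = b k + eps * y.
Proof.
rewrite /b; elim: (2 * v)%N => [|m [y IHy]].
  by exists 0; rewrite !big_ord0 mulr0 addr0.
rewrite !big_ord_recr /= IHy.
have -> : k - n%:Z + m.+1%:Z = k + m.+1%:Z - (1 * n)%:Z by lia.
rewrite sg_shift; set p := \prod_(i < m) _; set s := sg _; set c := qcosym _ _.
by exists (y * s - (p + eps * y) * (1 * d)%:R * c); ring.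
Qed.

Let V (k : int) := sg (2 * k + t%:Z) * b k ^+ d.

(** To first order in [eps], the difference of [T] and [Tsym] carries [w'] with multiplicity
    [d - 1 = 2h] and [y] with multiplicity [h]; the difference of [V] carries them [2d] and [d]
    times. The ratios agree. *)
Let T_sub_Tsym (k : nat) : (k < n)%N ->
  d%:R * b 0 * (T k * b 0 ^+ (2 * h) - Tsym k) =
  h%:R * (V k%:Z - V (k%:Z - n%:Z)).
Proof.
move=> ltkn; rewrite T_eq // /Tsym /V.
set i := 2 * k%:Z + t%:Z.
have -> : d%:Z * i - n%:Z = d%:Z * i - (1 * n)%:Z by rewrite mul1n.
have -> : 2 * k%:Z - M%:Z = i - (1 * n)%:Z by rewrite /i nE; lia.
have -> : 2 * (k%:Z - n%:Z) + t%:Z = i - (2 * n)%:Z by rewrite /i; lia.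
rewrite qsym_shift // !sg_shift -/eps.
have [y ->] := b_shift k%:Z.
rewrite -/(sg i); set w := sg i; set w' := qcosym _ _; set B := b k%:Z.
have Ce : eps * C k * b 0 = eps * B by rewrite eps_C // mulrVK.
move: dv_lt; rewrite /d.
case: h h_gt0 => // h0 _ _.
(* This form of the exponent expresses all powers of [B] through [B ^+ h0], which [ring] treats as
   an atom. *)
have -> : (2 * h0.+1 = (h0 + h0.+1).+1)%N by lia.
rewrite exprMn !(add_eps_exp eps_sq) !exprS exprD !exprS -/eps.
set X := B ^+ h0; set D := (h0 + h0.+1).+2%:R; set H := h0.+1%:R.
have D_H : D = 2 * H + 1 by rewrite /D /H; ring.
have -> : (1 * (h0 + h0.+1).+2)%:R = D by rewrite mul1n.
have -> : (2 * (h0 + h0.+1).+2)%:R = 2 * D by rewrite natrM.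
(* On both sides only multiples of eps survive, and eps * C k = eps * B / b 0. *)
pose Z := 2 * H * w' * X ^+ 2 * B ^+ 2 - H * w * y * X ^+ 2 * B.
transitivity (D * Z * (eps * C k * b 0) +
    eps * eps * (D * b 0 * C k * D * w' * H * y * X ^+ 2 * B)).
  by rewrite /Z D_H; ring.
transitivity (D * Z * (eps * B) +
    eps * eps * (2 * H * D * w' * D * y * X ^+ 2 * B ^+ 2)).
  by rewrite Ce eps_sq !mul0r.
by rewrite /Z; ring.
Qed.

(** The factor [sg (2k + t)] has degree 2 and [b k ^+ d] has degree [2dv]; half the total is below
    [n] by [dv_lt]. *)
Let V_laurent : laurent (q ^+ d) (2 * (d * v).+1) V.
Proof.
have gE i : sg i = (q ^+ d) ^ i - (q ^+ d) ^ (- i).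
  by rewrite /sg /qsym exprnP !exprz_exp mulrN.
have g_unit : q ^+ d \is a GRing.unit by rewrite unitrX.
have Lb : laurent (q ^+ d) (2 * v * 1) b.
  apply: (laurent_prod g_unit _ (f := fun j k => sg (k + j.+1%:Z))) => j.
  have [P sP E] := laurent_qsym g_unit 1 j.+1%:Z.
  by exists P => // k; rewrite -E gE mul1r.
have [P sP E] := laurent_mul g_unit (laurent_qsym g_unit 2 t%:Z)
  (laurent_exp g_unit d Lb).
exists P => [|k]; first by apply: leq_trans sP _; lia.
rewrite /V gE E; congr (q ^+ d ^ _ * _); lia.
Qed.

Hypothesis d_unit : (d%:R : A) \is a GRing.unit.

Lemma truncated_sum_eq0 :
  \sum_(k < n) qsym q (d%:Z * (2 * k%:Z + t%:Z) - n%:Z) *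
    (\prod_(j < k) qsym q (d%:Z * (t%:Z + j%:Z) - n%:Z)) ^+ d /
    (\prod_(j < k) qsym q (d%:Z * j.+1%:Z)) ^+ d = 0.
Proof.
transitivity (\sum_(k < n) T k) => //.
have b0n_unit := unitrX (2 * h) b0_unit.
(* These unit factors and the subtracted zero sum of [Tsym] give the left side of [T_sub_Tsym]. *)
apply: (mulIr b0n_unit); apply: (mulrI b0_unit); apply: (mulrI d_unit).
rewrite mul0r !mulr0 mulrA mulr_suml -[X in _ * X = _]subr0 -[X in _ - X]Tsym_sum.
rewrite -sumrB mulr_sumr.
under eq_bigr do rewrite T_sub_Tsym //.
rewrite -mulr_sumr (sum_shift_laurent (g := q ^+ d) (m := (d * v).+1)) ?mulr0 //.
- by rewrite unitrX.
- have -> : (q ^+ d ^ 2) ^+ n = q ^+ n ^+ (d * 2).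
    by rewrite -[_ ^ 2]exprnP -!exprM; congr (q ^+ _); lia.
  by rewrite subrX1 exprMn expr2 eps_sq mul0r.
move=> i i_lt; have := sg_unit i_lt; rewrite /sg qsym_factor // unitrM.
case/andP => _; rewrite !exprnP !exprz_exp.
by rewrite !mulrA [2 * _]mulrC.
Qed.

End TruncatedSum.

(** * Reducing rational functions modulo a monic polynomial *)

Section Reduction.

Variable P : {poly rat}.
Hypothesis P_monic : P \is monic.
Hypothesis P_size : (1 < size P)%N.

(** The quotient is taken by [mk_monic P], which falls back to ['X] unless [P] is monic and
    nonconstant. *)
Let mkP : mk_monic P = P.
Proof. by rewrite /mk_monic P_size P_monic. Qed.

Lemma in_qpoly_eq0 a : (in_qpoly P a == 0) = (P %| a).
Proof.
rewrite -val_eqE /= -Pdiv.IdomainMonic.modpE ?monic_mk_monic // mkP.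
by rewrite /dvdp.
Qed.

Lemma in_qpoly_unit a : (in_qpoly P a \is a GRing.unit) = coprimep P a.
Proof.
rewrite -[LHS]/(coprimep (mk_monic P) _) /=.
by rewrite -Pdiv.IdomainMonic.modpE ?monic_mk_monic // mkP coprimep_modr.
Qed.

(** A relation, since only fractions with a denominator prime to [P] have an image in the
    quotient. *)
Definition reduces_to (x : RF) (y : {poly %/ P}) : Prop :=
  exists a b, [/\ in_qpoly P b \is a GRing.unit, x = tofrac a / tofrac b
    & y = in_qpoly P a / in_qpoly P b].

Let tofrac_neq0 b : in_qpoly P b \is a GRing.unit -> tofrac b != 0 :> RF.
Proof.
apply: contraTneq => /eqP; rewrite tofrac_eq0 => /eqP ->.
by rewrite rmorph0 unitr0.
Qed.

Lemma reduces_poly a : reduces_to (tofrac a) (in_qpoly P a).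
Proof. by exists a, 1; rewrite !rmorph1 !divr1 unitr1. Qed.

Lemma reduces_add x1 x2 y1 y2 :
  reduces_to x1 y1 -> reduces_to x2 y2 -> reduces_to (x1 + x2) (y1 + y2).
Proof.
move=> [a1 [b1 [U1 -> ->]]] [a2 [b2 [U2 -> ->]]].
exists (a1 * b2 + a2 * b1), (b1 * b2); split.
- by rewrite rmorphM unitrM U1.
- by rewrite addf_div ?tofrac_neq0 // !rmorphD !rmorphM.
have Ub := unitrM (in_qpoly P b1) (in_qpoly P b2); rewrite U1 U2 in Ub.
rewrite !rmorphD !rmorphM; apply: (mulIr Ub); rewrite mulrVK // mulrDl.
by rewrite [in X in _ + X](mulrC (in_qpoly P b1)) !mulrA !mulrVK.
Qed.

Lemma reduces_mul x1 x2 y1 y2 :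
  reduces_to x1 y1 -> reduces_to x2 y2 -> reduces_to (x1 * x2) (y1 * y2).
Proof.
move=> [a1 [b1 [U1 -> ->]]] [a2 [b2 [U2 -> ->]]].
exists (a1 * a2), (b1 * b2); split.
- by rewrite rmorphM unitrM U1.
- by rewrite mulf_div !rmorphM.
by rewrite !rmorphM invrM // mulrACA [X in _ * X]mulrC.
Qed.

Lemma reduces_inv x y :
  reduces_to x y -> y \is a GRing.unit -> reduces_to x^-1 y^-1.
Proof.
move=> [a [b [Ub -> ->]]]; rewrite unitrM => /andP[Ua _].
by exists b, a; rewrite invf_div invrM ?invrK // ?unitrV.
Qed.

Lemma reduces_opp x y : reduces_to x y -> reduces_to (- x) (- y).
Proof.
by rewrite -mulN1r -[- y]mulN1r; apply: reduces_mul; have := reduces_poly (- 1);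
  rewrite !rmorphN !rmorph1.
Qed.

Lemma reduces_sum (I : finType) (f : I -> RF) (g : I -> {poly %/ P}) :
  (forall k, reduces_to (f k) (g k)) -> reduces_to (\sum_k f k) (\sum_k g k).
Proof.
move=> fg; apply: (big_rec2 reduces_to) => [|k y x _]; last exact: reduces_add.
by have := reduces_poly 0; rewrite !rmorph0.
Qed.

Lemma reduces_prod (I : finType) (f : I -> RF) (g : I -> {poly %/ P}) :
  (forall k, reduces_to (f k) (g k)) -> reduces_to (\prod_k f k) (\prod_k g k).
Proof.
move=> fg; apply: (big_rec2 reduces_to) => [|k y x _]; last exact: reduces_mul.
by have := reduces_poly 1; rewrite !rmorph1.
Qed.

Lemma reduces_exp m x y : reduces_to x y -> reduces_to (x ^+ m) (y ^+ m).
Proof.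
move=> xy; elim: m => [|m IHm]; last by rewrite !exprS; apply: reduces_mul.
by have := reduces_poly 1; rewrite !rmorph1.
Qed.

Lemma reduces_expz (i : int) x y :
  reduces_to x y -> y \is a GRing.unit -> reduces_to (x ^ i) (y ^ i).
Proof.
move=> xy Uy; case: i => m; first exact: reduces_exp.
by apply: reduces_inv; [exact: reduces_exp | rewrite unitrX].
Qed.

Lemma reduces_qsym x y i :
  reduces_to x y -> y \is a GRing.unit -> reduces_to (qsym x i) (qsym y i).
Proof.
move=> xy Uy; apply: reduces_add; first exact: reduces_expz.
by apply: reduces_opp; apply: reduces_expz.
Qed.

Lemma reduces_congr_mod x : reduces_to x 0 -> congr_mod x 0 P.
Proof.
move=> [a [b [Ub -> E]]].
have: in_qpoly P a == 0 by rewrite -(mulrVK Ub (in_qpoly P a)) -E mul0r.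
rewrite in_qpoly_eq0 => /dvdpP[c ->].
exists c, b; rewrite coprimep_sym -in_qpoly_unit Ub subr0 [P * c]mulrC.
by split=> //; rewrite -tofrac_eq0 tofrac_neq0.
Qed.

End Reduction.

(** * Cyclotomic polynomials over the rationals *)

Lemma PhiQ_monic n : PhiQ n \is monic.
Proof. by rewrite monic_map // Cyclotomic_monic. Qed.

Lemma PhiQ_dvd n : (0 < n)%N -> PhiQ n %| 'X^n - 1.
Proof.
move=> n_gt0.
have -> : 'X^n - 1 = map_poly intr ('X^n - 1) :> {poly rat}.
  by rewrite rmorphB rmorph1 /= map_polyXn.
rewrite -prod_Cyclotomic // (big_rem n) /=; last by rewrite -dvdn_divisors.
by rewrite rmorphM dvdp_mulr.
Qed.

(** Over [algC] the roots of [PhiQ n] are the primitive [n]-th roots of unity, and [x ^+ m = 1] for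
    one of them forces [n] to divide [m]. *)
Lemma PhiQ_coprime n m : (0 < n)%N -> ~~ (n %| m)%N ->
  coprimep (PhiQ n) ('X^m - 1).
Proof.
move=> n_gt0 ndvd; rewrite -(coprimep_map (ratr : rat -> algC)).
have [z prim_z] := C_prim_root_exists n_gt0.
have -> : map_poly ratr (PhiQ n) = cyclotomic z n :> {poly algC}.
  rewrite -(Cintr_Cyclotomic prim_z) /PhiQ -map_poly_comp.
  by apply: eq_map_poly => a /=; rewrite rmorph_int.
rewrite rmorphB rmorph1 /= map_polyXn.
apply/Pdiv.ClosedField.coprimepP => x; rewrite root_cyclotomic // => prim_x.
apply: contra ndvd; rewrite /root !hornerE subr_eq0 => xm.
by rewrite (prim_order_dvd prim_x).
Qed.

(** * The summands in terms of symmetric q-numbers *)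

Lemma qq_neq0 : qq != 0.
Proof. by rewrite tofrac_eq0 polyX_eq0. Qed.

Lemma one_sub_qpow (m : int) : 1 - qpow (2 * m) = - qq ^ m * qsym qq m.
Proof.
rewrite qsym_factor ?unitfE ?qq_neq0 // mulNr mulrA -expfzDr ?qq_neq0 //.
by rewrite subrr mul1r opprB.
Qed.

Lemma qint2_qsym m : qint2 m = qq ^ (m - 1) * (qsym qq m / qsym qq 1).
Proof.
have E1 := one_sub_qpow 1; rewrite mulr1 in E1.
rewrite /qint2 one_sub_qpow E1 expfzDr ?qq_neq0 //.
by rewrite -mulf_div invrN mulrNN -exprz_inv !expr1z mulrA.
Qed.

(** In each quotient of factors the signs cancel and the powers of [qq] leave [qq ^ (r - d)]. *)
Lemma qpoch_div_qsym (r d : int) k :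
  qpoch (qpow (2 * r)) (qpow (2 * d)) k / qpoch (qpow (2 * d)) (qpow (2 * d)) k =
  qq ^ ((r - d) * k%:Z) * ((\prod_(j < k) qsym qq (r + d * j%:Z)) /
                   (\prod_(j < k) qsym qq (d * j.+1%:Z))).
Proof.
have factorE s (j : nat) : 1 - qpow (2 * s) * qpow (2 * d) ^+ j =
    - qq ^ (s + d * j%:Z) * qsym qq (s + d * j%:Z).
  rewrite -one_sub_qpow /qpow exprnP exprz_exp -expfzDr ?qq_neq0 //.
  by congr (1 - qq ^ _); lia.
rewrite /qpoch; elim: k => [|k IHk]; first by rewrite !big_ord0 mulr0 expr0z mul1r.
rewrite !big_ord_recr /= -!mulf_div IHk !factorE -mulf_div invrN mulrNN.
have -> : d + d * k%:Z = d * k.+1%:Z by lia.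
have -> : qq ^ ((r - d) * k.+1%:Z) =
    qq ^ ((r - d) * k%:Z) * (qq ^ (r + d * k%:Z) / qq ^ (d * k.+1%:Z)).
  by rewrite invr_expz -!expfzDr ?qq_neq0 //; congr (qq ^ _); lia.
by rewrite mulrACA.
Qed.

(** The exponents [2dk + r - 1], [d(r - d)k] and [d(d - r - 2)k] add up to [r - 1], free of [k]. *)
Lemma summand_qsym (d k : nat) (r : int) :
  qint2 ((2 * d * k)%:Z + r)
    * (qpoch (qpow (2 * r)) (qpow (2 * d%:Z)) k) ^+ d
    / (qpoch (qpow (2 * d%:Z)) (qpow (2 * d%:Z)) k) ^+ d
    * qpow (d%:Z * (d%:Z - r - 2) * k%:Z) =
  qq ^ (r - 1) / qsym qq 1 *
  (qsym qq ((2 * d * k)%:Z + r) * (\prod_(j < k) qsym qq (r + d%:Z * j%:Z)) ^+ d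
    / (\prod_(j < k) qsym qq (d%:Z * j.+1%:Z)) ^+ d).
Proof.
rewrite -[_ * _ / _]mulrA -expr_div_n qpoch_div_qsym qint2_qsym exprMn expr_div_n.
rewrite exprnP exprz_exp /qpow.
set i := (_ - 1 : int); set j := _ * d%:Z; set l := _ * k%:Z.
have -> : r - 1 = i + j + l by rewrite /i /j /l; lia.
by rewrite !expfzDr ?qq_neq0 //; ring.
Qed.

(** * Choice of parameters and transfer to the quotient ring *)

Theorem theorem7 (d : nat) (r : int) (n : nat) :
  (5 <= d)%N -> odd d -> ~~ odd `|r|%N -> gcdn d `|r|%N = 1%N ->
  (1 < n)%N -> odd n ->
  (n%:Z = - r %[mod d%:Z])%Z ->
  r <= n%:Z -> d%:Z - r <= n%:Z ->
  congr_mod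
    (\sum_(k < n)
        qint2 ((2 * d * k)%:Z + r)
        * (qpoch (qpow (2 * r)) (qpow (2 * d%:Z)) k) ^+ d
        / (qpoch (qpow (2 * d%:Z)) (qpow (2 * d%:Z)) k) ^+ d
        * qpow (d%:Z * (d%:Z - r - 2) * k%:Z))
    0 (PhiQ n ^+ 2).
Proof.
move=> d_ge5 d_odd r_even d_r n_gt1 n_odd n_r r_le d_le.
have [h d_def] : exists h, d = (2 * h).+1 by exists d./2; lia.
have [t t_def] : exists t : int, n%:Z + r = t * d%:Z.
  have /dvdzP[t Et] : (d%:Z %| n%:Z - - r)%Z by rewrite -eqz_mod_dvd; apply/eqP.
  by exists t; rewrite -Et opprK.
(* [t] is positive because [n + r >= d], and odd because [n + r] is odd. *)
have [v v_def] : exists v : nat, t = (2 * v).+1%:Z.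
  have d_gt0 : 0 < d%:Z by lia.
  have t_gt0 : 0 < t by rewrite -(pmulr_lgt0 _ d_gt0) -t_def; lia.
  have t_odd : odd (absz t).
    have : odd (absz (t * d%:Z)) by rewrite -t_def; lia.
    by rewrite abszM oddM => /andP[].
  by exists (absz t)./2; lia.
have r_def : r = d%:Z * (2 * v).+1%:Z - n%:Z by lia.
(* From [r <= n] follows [d(2v + 1) <= 2n], and [d >= 5] leaves the margin. *)
have dv_lt : ((d * v).+1 < n)%N by lia.
(* A common divisor of [d] and [n] divides [r]. *)
have n_d : coprime n d.
  rewrite coprime_sym; apply/eqP/eqP; rewrite -dvdn1 -d_r dvdn_gcd dvdn_gcdl /=.
  have : (gcdn d n %| absz (d%:Z * (2 * v).+1%:Z - n%:Z)%R)%N.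
    have := dvdn_gcdr d n; have := dvdn_gcdl d n; set g := gcdn d n => gd gn.
    suff: (g%:Z %| d%:Z * (2 * v).+1%:Z - n%:Z)%Z by rewrite dvdzE.
    by rewrite rpredB // dvdz_mulr.
  by rewrite -r_def.
set P := PhiQ n ^+ 2; have n_gt0 : (0 < n)%N by lia.
have P_monic : P \is monic by rewrite monic_exp ?PhiQ_monic.
have P_size : (1 < size P)%N.
  have sizeE : (size (PhiQ n)).-1 = totient n.
    by rewrite size_map_inj_poly ?size_Cyclotomic //; exact: intr_inj.
  by rewrite -subn_gt0 subn1 size_exp sizeE muln_gt0 totient_gt0 n_gt0.
pose A : comUnitRingType := {poly %/ P}; pose q : A := in_qpoly P 'X.
have Xn1 m : in_qpoly P ('X^m - 1) = q ^+ m - 1 by rewrite rmorphB rmorphXn rmorph1.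
have eps_sq : (q ^+ n - 1) * (q ^+ n - 1) = 0.
  rewrite -Xn1 -rmorphM; apply/eqP; rewrite in_qpoly_eq0 // /P expr2.
  by rewrite dvdp_mul ?PhiQ_dvd.
have q_unit : q \is a GRing.unit.
  (* The inverse of [q ^+ n = 1 + eps] is [1 - eps]. *)
  rewrite -(unitrX_pos _ n_gt0); apply/unitrP; exists (2 - q ^+ n).
  have E : (2 - q ^+ n) * q ^+ n = 1 - (q ^+ n - 1) * (q ^+ n - 1) by ring.
  by rewrite [_ * (2 - _)]mulrC E eps_sq subr0.
(* As [n] is odd, it does not divide [2m] either. *)
have qsym_unit m : ~~ (n %| m)%N -> qsym q m%:Z \is a GRing.unit.
  move=> ndvd; rewrite qsym_factor // unitrM unitrXz //= -PoszM -exprnP -Xn1.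
  rewrite in_qpoly_unit // coprimep_expl // PhiQ_coprime //.
  by rewrite Gauss_dvdr // coprimen2.
have nat_unit m : (0 < m)%N -> (m%:R : A) \is a GRing.unit.
  move=> m_gt0; rewrite -(rmorph_nat (in_qpoly P \o polyC)) rmorph_unit //.
  by rewrite unitfE pnatr_eq0 -lt0n.
have qq_q : reduces_to (P := P) qq q by apply: reduces_poly.
apply: reduces_congr_mod => //.
under eq_bigr do rewrite summand_qsym.
rewrite -mulr_sumr.
(* The target 0 is the image of the prefactor times the vanishing truncated sum. *)
rewrite -(mulr0 (q ^ (r - 1) / qsym q 1)).
have one_unit : qsym q 1 \is a GRing.unit by rewrite qsym_unit // dvdn1; lia.
have di_unit i : (0 < i < n)%N -> qsym q (d%:Z * i%:Z) \is a GRing.unit.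
  move=> i_lt; rewrite -PoszM qsym_unit // Gauss_dvdr //.
  by apply/negP => /dvdn_leq; lia.
apply: reduces_mul.
  apply: reduces_mul; first exact: reduces_expz.
  by apply: reduces_inv => //; apply: reduces_qsym.
have := truncated_sum_eq0 (q := q) (n := n) (h := h) (v := v).
rewrite -d_def => <- //; [|by lia|by apply: nat_unit|by apply: nat_unit; lia].
apply: reduces_sum => k.
have -> : (2 * d * k)%:Z + r = d%:Z * (2 * k%:Z + (2 * v).+1%:Z) - n%:Z by lia.
have fact_unit : \prod_(j < k) qsym q (d%:Z * j.+1%:Z) \is a GRing.unit.
  apply: rpred_prod => j _; apply: di_unit.
  by have := ltn_ord k; have := ltn_ord j; lia.
apply: reduces_mul.
  apply: reduces_mul; first exact: reduces_qsym.
  apply: reduces_exp; apply: reduces_prod => j.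
  have -> : r + d%:Z * j%:Z = d%:Z * ((2 * v).+1%:Z + j%:Z) - n%:Z by lia.
  exact: reduces_qsym.
apply: reduces_inv; last by rewrite unitrX.
by apply: reduces_exp; apply: reduces_prod => j; apply: reduces_qsym.
Qed.
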